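(* Let $n\ge 3$ and let $t,r$ be positive integers with $t\ge r$. Let $[d,D]=\mathcal{D}_{t,r}(S_n)$. Then for every integer $x\in[d,D]$ there exists an orientation $\vec{S}_{n_x}$ of $S_n$ with $\gamma_{t,r}(\vec{S}_{n_x})=x$.
   Context: The star $S_n$ consists of one central vertex adjacent to $n-1$ leaves. An orientation assigns to every edge exactly one direction. For vertices $u,v$ of an oriented graph, $d(u,v)$ is the minimum length of a directed path from $u$ to $v$ ($d(u,u)=0$; $\infty$ if none exists). Given positive integers $t,r$ and $S\subseteq V$, the directed reception at $w$ is $\vec{r}(w)=\sum_{v\in S,\ d(v,w)<t}(t-d(v,w))$; $S$ is a directed $(t,r)$ broadcast dominating set if $\vec{r}(w)\ge r$ for every vertex $w$, and $\gamma_{t,r}(\vec{G})$ is its minimum cardinality. $\mathcal{D}_{t,r}(G)$ is the integer interval $[d,D]$ where $d$ and $D$ are the minimum and maximum of $\gamma_{t,r}(\vec{G})$ over all orientations $\vec{G}$ of $G$. *)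

(* Defs.v *)
From mathcomp Require Import all_boot.

Set Implicit Arguments.
Unset Strict Implicit.
Unset Printing Implicit Defensive.

(* Adjacency of the star with [n] vertices; the center is the vertex 0. *)
Definition star (n : nat) : rel 'I_n :=
  [rel u v | (u != v) && ((val u == 0) || (val v == 0))].

Section Broadcast.

Variable V : finType.

(* An orientation of the simple graph with adjacency [e] is represented by its
   set of arcs; [(u, v)] stands for the arc from [u] to [v]. *)
Definition is_orientation (e : rel V) (A : {set V * V}) : bool :=
  [forall u, forall v,
    if e u v then ((u, v) \in A) (+) ((v, u) \in A) else (u, v) \notin A].

Variable A : {set V * V}.

Definition arc : rel V := [rel u v | (u, v) \in A].

Definition has_dipath (k : nat) (u v : V) : bool :=
  [exists p : k.-tuple V, [&& path arc u p, last u p == v & uniq (u :: p)]].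

(* [None] is the infinite distance. A path has fewer than [#|V|] arcs, so the
   lengths below [#|V|] are the only ones to consider. *)
Definition dist (u v : V) : option nat :=
  ohead [seq k <- iota 0 #|V| | has_dipath k u v].

Definition reception (t : nat) (S : {set V}) (w : V) : nat :=
  \sum_(v in S)
    (if dist v w is Some k then if k < t then t - k else 0 else 0).

Definition broadcast_dominating (t r : nat) (S : {set V}) : bool :=
  [forall w, r <= reception t S w].

(* The initial value [#|V|] bounds every [#|S|], so it never lowers the minimum;
   it is the value of [broadcast_number] when there is no dominating set, which
   requires [t < r]: see [broadcast_numberP]. *)
Definition broadcast_number (t r : nat) : nat :=
  \big[minn/#|V|]_(S : {set V} | broadcast_dominating t r S) #|S|.

End Broadcast.

(* Again [#|V|] bounds every [broadcast_number]. *)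
Definition min_broadcast (V : finType) (e : rel V) (t r : nat) : nat :=
  \big[minn/#|V|]_(A : {set V * V} | is_orientation e A) broadcast_number A t r.

Definition max_broadcast (V : finType) (e : rel V) (t r : nat) : nat :=
  \max_(A : {set V * V} | is_orientation e A) broadcast_number A t r.

Definition broadcast_interval (V : finType) (e : rel V) (t r : nat) : pred nat :=
  [pred x | min_broadcast e t r <= x <= max_broadcast e t r].

(* The minima and maxima above are attained. *)

Lemma bigmin_le (I : finType) (P : pred I) (F : I -> nat) (m : nat) (i : I) :
  P i -> \big[minn/m]_(j | P j) F j <= F i.
Proof.
move=> Pi; have: i \in index_enum I by rewrite mem_index_enum.
elim: (index_enum I) => // j s IHs; rewrite inE big_cons => /predU1P[<-|/IHs le_s].
- by rewrite Pi geq_minl.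
- by case: ifP => // _; apply: leq_trans (geq_minr _ _) le_s.
Qed.

Lemma bigmin_attained (I : finType) (P : pred I) (F : I -> nat) (m : nat) (i : I) :
  P i -> F i <= m -> exists2 j, P j & \big[minn/m]_(k | P k) F k = F j.
Proof.
move=> Pi Fi.
case: (arg_minnP F Pi) => j Pj minj; exists j => //.
apply/eqP; rewrite eqn_leq bigmin_le //=.
elim/big_ind: _ => [|x y lex ley|k Pk]; last exact: minj.
- exact: leq_trans (minj i Pi) Fi.
- by rewrite leq_min lex ley.
Qed.

Lemma dist_refl (V : finType) (A : {set V * V}) (u : V) : dist A u u = Some 0.
Proof.
have V_gt0 : 0 < #|V| by apply/card_gt0P; exists u.
rewrite /dist -(prednK V_gt0) /=.
suff -> : has_dipath A 0 u u by [].
by apply/existsP; exists [tuple]; rewrite /= eqxx.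
Qed.

Lemma dominatingT (V : finType) (A : {set V * V}) (t r : nat) :
  0 < r -> r <= t -> broadcast_dominating A t r [set: V].
Proof.
move=> r_gt0 le_rt; apply/forallP=> w; rewrite /reception (bigD1 w) ?inE //=.
by rewrite dist_refl subn0 (leq_trans r_gt0 le_rt) (leq_trans le_rt) ?leq_addr.
Qed.

Lemma broadcast_numberP (V : finType) (A : {set V * V}) (t r : nat) :
  0 < r -> r <= t ->
  (exists2 S, broadcast_dominating A t r S & #|S| = broadcast_number A t r) /\
  (forall S, broadcast_dominating A t r S -> broadcast_number A t r <= #|S|).
Proof.
move=> r_gt0 le_rt; split; last by move=> S /bigmin_le; apply.
have [|S domS eqS] :=
  bigmin_attained (F := fun S : {set V} => #|S|) (dominatingT A r_gt0 le_rt)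
    (m := #|V|).
  exact: max_card.
by exists S.
Qed.

Lemma broadcast_number_le (V : finType) (A : {set V * V}) (t r : nat) :
  broadcast_number A t r <= #|V|.
Proof.
rewrite /broadcast_number; elim/big_ind: _ => // [x y lex _|S _].
- exact: leq_trans (geq_minl _ _) lex.
- exact: max_card.
Qed.

Lemma min_broadcastP (V : finType) (e : rel V) (t r : nat) (A0 : {set V * V}) :
  is_orientation e A0 ->
  (exists2 A, is_orientation e A & broadcast_number A t r = min_broadcast e t r)
  /\ (forall A, is_orientation e A -> min_broadcast e t r <= broadcast_number A t r).
Proof.
move=> oA0; split; last by move=> A oA; apply: bigmin_le.
have [A oA eqA] := bigmin_attained (F := fun A => broadcast_number A t r) oA0
  (broadcast_number_le A0 t r).
by exists A.
Qed.

Lemma max_broadcastP (V : finType) (e : rel V) (t r : nat) (A0 : {set V * V}) :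
  is_orientation e A0 ->
  (exists2 A, is_orientation e A & broadcast_number A t r = max_broadcast e t r)
  /\ (forall A, is_orientation e A -> broadcast_number A t r <= max_broadcast e t r).
Proof.
move=> oA0; split; last first.
  by move=> A oA; rewrite /max_broadcast (bigD1 A) //= leq_maxl.
have [|A oA eqA] := eq_bigmax_cond (A := [pred A | is_orientation e A])
  (fun A => broadcast_number A t r); first by apply/card_gt0P; exists A0.
by exists A.
Qed.

Lemma star_orientable (n : nat) :
  is_orientation (@star n) [set a | (val a.1 == 0) && (val a.2 != 0)].
Proof.
apply/forallP=> u; apply/forallP=> v; rewrite /star /= !inE /= -val_eqE /=.
by case: (val u) => [|i]; case: (val v) => [|j]; rewrite //= ?andbF.
Qed.

(* Main.v *)
Require Import Defs.
From mathcomp Require Import all_boot.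

(** Turning a sink [v] of the star into a source raises the broadcast number by
    at most one: adding [v] to a dominating set keeps it dominating, because a
    path that ends elsewhere never visits the sink [v]. Starting from an
    orientation that attains the minimum and turning the sinks one by one, the
    broadcast number thus takes every value up to that of the orientation
    towards the center, which is at least [n - 1] since each source has to
    belong to the dominating set. The only value possibly left is [n], and
    when it lies in the interval it is the maximum, which is attained. *)

Set Implicit Arguments.
Unset Strict Implicit.
Unset Printing Implicit Defensive.

(** [dist] is the head of such a filtered list, that is, the least admissible length. Weakening the
    predicate can only bring this head forward. *)
Lemma ohead_filter_iota_le (p q : pred nat) (m n k : nat) :
  subpred p q -> ohead (filter p (iota m n)) = Some k ->
  exists2 k', ohead (filter q (iota m n)) = Some k' & k' <= k.
Proof.
move=> pq; elim: n m => //= n IHn m; case: ifP => [/pq -> [<-]|_ hk].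
  by exists m.
case: ifP => _; last exact: IHn.
exists m => //; have : k \in filter p (iota m.+1 n).
  by case: (filter _ _) hk => //= a s [->]; rewrite mem_head.
by rewrite mem_filter mem_iota => /and3P[_ /ltnW].
Qed.

Section Reorient.

Variables (V : finType) (A A' : {set V * V}) (t r : nat).

Lemma dist_le (u w : V) (k : nat) :
  (forall j, has_dipath A j u w -> has_dipath A' j u w) ->
  dist A u w = Some k -> exists2 k', dist A' u w = Some k' & k' <= k.
Proof. exact: ohead_filter_iota_le. Qed.

(** A path from [u] to a different vertex [w] has a last arc, which would enter [w]. *)
Lemma dist_source (u w : V) :
  (forall x, (x, w) \notin A) -> u != w -> dist A u w = None.
Proof.
move=> src_w neq_uw; rewrite /dist (@eq_in_filter _ _ pred0) ?filter_pred0 //.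
move=> k _; apply/existsP=> -[p /and3P[]].
case/lastP: (tval p) => [|s x] /=; first by rewrite (negbTE neq_uw).
rewrite rcons_path last_rcons => /andP[_ Ax] /eqP eq_xw.
by move: Ax; rewrite /Defs.arc /= eq_xw (negbTE (src_w _)).
Qed.

(** A source hears nobody but itself, so outside [S] its reception is zero, below [r]. *)
Lemma source_in_dominating (S : {set V}) (w : V) :
  0 < r -> (forall x, (x, w) \notin A) ->
  broadcast_dominating A t r S -> w \in S.
Proof.
move=> r_gt0 src_w /forallP/(_ w); apply: contraLR => wNS.
rewrite -ltnNge /reception big1 // => u uS.
by rewrite dist_source //; apply: contraNneq wNS => <-.
Qed.

Variable v : V.
Hypothesis sink_v : forall x, (v, x) \notin A.
Hypothesis sub_A : forall x y, y != v -> (x, y) \in A -> (x, y) \in A'.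

Lemma has_dipath_reorient (k : nat) (u w : V) :
  w != v -> has_dipath A k u w -> has_dipath A' k u w.
Proof.
move=> neq_wv /existsP[p /and3P[Ap /eqP last_p Up]]; apply/existsP; exists p.
rewrite last_p eqxx Up !andbT; move: Ap last_p {Up}.
elim: (tval p) u => //= y s IHs u /andP[Auy As] last_s.
(* If the path entered [v], it would either stop there, against [w != v], or leave the sink. *)
rewrite IHs // andbT; apply: sub_A Auy; apply: contraNneq neq_wv => eq_yv.
move: As last_s; rewrite eq_yv; case: s {IHs} => [_ <- //|z s] /=.
by rewrite {1}/Defs.arc /= (negbTE (sink_v z)).
Qed.

Lemma dominating_reorient (S : {set V}) :
  r <= t -> broadcast_dominating A t r S ->
  broadcast_dominating A' t r (v |: S).
Proof.
move=> le_rt /forallP domS; apply/forallP=> w.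
have [->|neq_wv] := eqVneq w v.
  (* At [v] its own signal [t] is enough; the degenerate case [t = 0] forces [r = 0]. *)
  rewrite /reception (bigD1 v) ?setU11 //= dist_refl subn0.
  case: ltnP => [_|]; first exact: leq_trans le_rt (leq_addr _ _).
  by rewrite leqn0 => /eqP t0; move: le_rt; rewrite t0 leqn0 => /eqP ->.
(* Elsewhere every term survives without loss, since distances to [w] do not grow. *)
apply: leq_trans (domS w) _; rewrite /reception big_mkcond [leqRHS]big_mkcond.
apply: leq_sum => u _; rewrite in_setU1; case: ifP => // _; rewrite orbT.
case dist_uw: (dist A u w) => [k|//].
have [k' -> le_k'k] :=
  dist_le (fun j => has_dipath_reorient (k := j) neq_wv) dist_uw.
by case: ifP => // lt_kt; rewrite (leq_ltn_trans le_k'k lt_kt) leq_sub2l.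
Qed.

Lemma broadcast_number_reorient :
  0 < r -> r <= t -> broadcast_number A' t r <= (broadcast_number A t r).+1.
Proof.
move=> r_gt0 le_rt; have [[S domS <-] _] := broadcast_numberP A r_gt0 le_rt.
have [_ /(_ _ (dominating_reorient le_rt domS)) le_A'] :=
  broadcast_numberP A' r_gt0 le_rt.
by apply: leq_trans le_A' _; rewrite cardsU1 -add1n leq_add2r leq_b1.
Qed.

End Reorient.

Section Star.

Variable m : nat.
Implicit Types (A : {set 'I_m.+1 * 'I_m.+1}) (u v : 'I_m.+1).

Lemma starE u v : @star m.+1 u v = (u == ord0) (+) (v == ord0).
Proof.
rewrite /star /= -[val u == 0]/(u == ord0) -[val v == 0]/(v == ord0).
have [->|u_n0] := eqVneq u ord0; first by rewrite eq_sym andbT.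
by have [->|] := eqVneq v ord0; rewrite ?u_n0 ?andbF.
Qed.

Lemma star_orientationP A :
  reflect ((forall v, v != ord0 -> ((ord0, v) \in A) = ((v, ord0) \notin A)) /\
           (forall u v, (u, v) \in A -> (u == ord0) (+) (v == ord0)))
    (is_orientation (@star m.+1) A).
Proof.
apply: (iffP forallP) => [oA|[oA loopA] u].
  split=> [v /negbTE v_n0|u v Auv].
    have /forallP/(_ v) := oA ord0; rewrite starE eqxx v_n0 /=.
    by case: (_ \in A); case: (_ \in A).
  by have /forallP/(_ v) := oA u; rewrite starE Auv; case: ifP.
apply/forallP=> v; rewrite starE; case: ifP => [|/negbT]; last first.
  by apply: contra => /loopA.
have [->|u_n0] := eqVneq u ord0; last by move/eqP->; rewrite oA ?addbN ?addbb.
by move=> v_n0; rewrite oA // addNb addbb.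
Qed.

(** In an orientation this makes the leaf [v] a source, whichever way its edge pointed. *)
Definition reverse_arc A v := (v, ord0) |: A :\ (ord0, v).

Lemma reverse_arc_orientation A v :
  v != ord0 -> is_orientation (@star m.+1) A ->
  is_orientation (@star m.+1) (reverse_arc A v).
Proof.
move=> v_n0 /star_orientationP[oA loopA]; apply/star_orientationP.
split=> [w w_n0|x y]; rewrite !inE !xpair_eqE.
  rewrite eqxx ![ord0 == _]eq_sym (negbTE v_n0) (negbTE w_n0) oA //.
  by case: eqVneq.
case/orP=> [/andP[/eqP -> /eqP ->]|/andP[_ /loopA //]].
by rewrite (negbTE v_n0) eqxx.
Qed.

Lemma broadcast_number_sources A t r :
  0 < r -> r <= t -> is_orientation (@star m.+1) A ->
  (forall v, (ord0, v) \notin A) -> m <= broadcast_number A t r.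
Proof.
move=> r_gt0 le_rt /star_orientationP[_ loopA] src.
have [[S domS <-] _] := broadcast_numberP A r_gt0 le_rt.
suff /subset_leq_card : [set~ ord0] \subset S by rewrite cardsC1 card_ord.
(* An arc into a leaf can only come from the center, so every leaf is a source here. *)
apply/subsetP=> v; rewrite !inE => v_n0.
apply: source_in_dominating r_gt0 _ domS => x; apply/negP=> Axv.
have := loopA _ _ Axv; rewrite (negbTE v_n0) addbF => /eqP x0.
by move: Axv; rewrite x0 (negbTE (src v)).
Qed.

Lemma broadcast_number_attained A t r x :
  0 < r -> r <= t -> is_orientation (@star m.+1) A ->
  broadcast_number A t r <= x <= m ->
  exists2 B, is_orientation (@star m.+1) B & broadcast_number B t r = x.
Proof.
(* Induction on the number of leaves that are sinks. *)
move=> r_gt0 le_rt; have [k] := ubnP #|[set v | (ord0, v) \in A]|.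
elim: k A => // k IHk A ltk oA /andP[le_Ax le_xm].
have [eq_x|neq_x] := eqVneq (broadcast_number A t r) x; first by exists A.
have lt_Ax : broadcast_number A t r < x by rewrite ltn_neqAle neq_x.
(* Without a sink leaf the broadcast number is at least [m >= x], a contradiction; otherwise a sink
   leaf is reversed. *)
have [src|[v]] := set_0Vmem [set v | (ord0, v) \in A].
  suff : m <= broadcast_number A t r.
    by move/leq_ltn_trans/(_ lt_Ax); rewrite ltnNge le_xm.
  apply: broadcast_number_sources => // v.
  by have /setP/(_ v) := src; rewrite !inE => ->.
rewrite inE => Av; have /star_orientationP[oA' loopA] := oA.
have v_n0 : v != ord0 by have := loopA _ _ Av; rewrite eqxx.
apply: (IHk (reverse_arc A v)); last 2 first.
- exact: reverse_arc_orientation.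
(* The number rises by at most one from below [x], so it cannot jump over [x]; a decrease does no
   harm. *)
- rewrite le_xm andbT; apply: leq_trans lt_Ax.
  apply: (broadcast_number_reorient (v := v)) => // [y|y z z_nv Ayz].
    apply/negP=> Avy; have := loopA _ _ Avy; rewrite (negbTE v_n0) => /eqP y0.
    by have := oA' v v_n0; rewrite Av -y0 Avy.
  by rewrite !inE !xpair_eqE (negbTE z_nv) andbF Ayz orbT.
rewrite -ltnS; apply: leq_trans ltk; rewrite ltnS; apply: proper_card.
apply/properP; split; last first.
  by exists v; rewrite !inE ?Av // !xpair_eqE !eqxx eq_sym (negbTE v_n0).
apply/subsetP=> w; rewrite !inE !xpair_eqE => /orP[|/andP[_ //]].
by rewrite eq_sym (negbTE v_n0).
Qed.

End Star.

Theorem mainTheorem8 (n t r : nat) :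
  3 <= n -> 0 < t -> 0 < r -> r <= t ->
  forall x : nat, x \in broadcast_interval (@star n) t r ->
  exists2 A : {set 'I_n * 'I_n},
    is_orientation (@star n) A & broadcast_number A t r = x.
Proof.
case: n => // m _ _ r_gt0 le_rt x /andP[le_minx le_xmax].
have [[A oA eqA] _] := min_broadcastP t r (star_orientable m.+1).
have [[B oB eqB] _] := max_broadcastP t r (star_orientable m.+1).
have [le_xm|lt_mx] := leqP x m.
  by apply: broadcast_number_attained oA _ => //; rewrite eqA le_minx.
(* Now [x] is at least [m.+1], the number of vertices, which bounds the maximum attained at [B]. *)
exists B => //; apply/eqP; rewrite eqn_leq eqB le_xmax andbT -eqB.
by apply: leq_trans (broadcast_number_le _ _ _) _; rewrite card_ord.
Qed.
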